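(* There exists a function $\varphi:\mathbb N\to\mathbb C$ such that the matrix $(\varphi(i+j))_{i,j\ge0}$ is a bounded Schur multiplier of $B(\ell_2)$, but such that there do not exist a Hilbert space $H$, a power bounded operator $T\in B(H)$ and vectors $\xi,\eta\in H$ with $$\varphi(n)=\langle T^n\xi,\eta\rangle\qquad\text{for all } n\in\mathbb N .$$
   Context: $\mathbb N=\{0,1,2,\dots\}$. An operator $T\in B(H)$ is power bounded if $\sup_{n\ge1}\|T^n\|<\infty$. A matrix $(a_{ij})_{i,j\ge0}$ is a bounded Schur multiplier of $B(\ell_2)$ if $(b_{ij})\mapsto(a_{ij}b_{ij})$ is a bounded map from $B(\ell_2)$ to itself. *)

(* Defs.v *)
From HB Require Import structures.
From mathcomp Require Import all_boot all_order all_algebra.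
From mathcomp Require Import complex ring.
From mathcomp Require Import all_classical all_reals all_analysis.

Set Implicit Arguments.
Unset Strict Implicit.
Unset Printing Implicit Defensive.

Import Order.TTheory GRing.Theory Num.Theory.
Import numFieldNormedType.Exports.

Local Open Scope classical_set_scope.
Local Open Scope ring_scope.

(* Norms of a normed space over R[i] take their values in R[i]; rnorm is the
   same norm with values in R. On R[i] itself it is the modulus. *)
Definition rnorm (R : realType) (V : normedZmodType R[i]) (x : V) : R :=
  complex.Re `|x|.

Section RealNorm.
Context (R : realType).

Lemma rnormE (V : normedZmodType R[i]) (x : V) : `|x| = ((rnorm x)%:C)%C.
Proof. by rewrite /rnorm RRe_real// normr_real. Qed.

Lemma rnorm_ge0 (V : normedZmodType R[i]) (x : V) : 0 <= rnorm x.
Proof. by rewrite -lecR -rnormE normr_ge0. Qed.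

Lemma rnorm0 (V : normedZmodType R[i]) : rnorm (0 : V) = 0.
Proof. by rewrite /rnorm normr0. Qed.

Lemma rnorm_eq0 (V : normedZmodType R[i]) (x : V) : rnorm x = 0 -> x = 0.
Proof. by move=> x0; apply/eqP; rewrite -normr_eq0 rnormE x0. Qed.

Lemma rnormD (V : normedZmodType R[i]) (x y : V) :
  rnorm (x + y) <= rnorm x + rnorm y.
Proof. by rewrite -lecR rmorphD/= -!rnormE ler_normD. Qed.

Lemma rnormM (x y : R[i]) : rnorm (x * y) = rnorm x * rnorm y.
Proof. by apply: complexI; rewrite rmorphM/= -!rnormE normrM. Qed.

End RealNorm.

Section Ell2.
Context (R : realType).

(* The squared ell2 norm of an arbitrary sequence, possibly +oo. *)
Definition sqnorm2 (x : nat -> R[i]) : \bar R :=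
  (\sum_(k <oo) ((rnorm (x k)) ^+ 2)%:E)%E.

Definition ell2_pred : {pred nat -> R[i]} :=
  fun x => `[< (sqnorm2 x < +oo)%E >].

Record ell2 : Type := Ell2 {
  ell2_seq :> nat -> R[i] ;
  ell2P : ell2_seq \in ell2_pred }.

HB.instance Definition _ := [isSub for ell2_seq].
HB.instance Definition _ := [Choice of ell2 by <:].

Lemma sqnorm2_ge0 x : (0 <= sqnorm2 x)%E.
Proof. by apply: nneseries_ge0 => k _ _; rewrite lee_fin sqr_ge0. Qed.

Lemma sqnorm2Z (a : R[i]) (x : nat -> R[i]) :
  sqnorm2 (a *: x) = ((rnorm a ^+ 2)%:E * sqnorm2 x)%E.
Proof.
rewrite /sqnorm2 -nneseriesZl; last by move=> k _; rewrite lee_fin sqr_ge0.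
by apply: eq_eseriesr => k _; rewrite -EFinM -exprMn -rnormM.
Qed.

Lemma sqnorm2D (t : R) (x y : nat -> R[i]) : 0 < t ->
  (sqnorm2 (x + y)%R <= (1 + t)%:E * sqnorm2 x + (1 + t^-1)%:E * sqnorm2 y)%E.
Proof.
move=> t0; have ti0 : 0 < t^-1 by rewrite invr_gt0.
have sq0 (z : R) : (0 <= (z ^+ 2)%:E)%E by rewrite lee_fin sqr_ge0.
rewrite /sqnorm2 -!nneseriesZl//; [|by move=> k _; exact: sq0..].
rewrite -nneseriesD; last first.
- by move=> k _ _; rewrite -EFinM lee_fin mulr_ge0 ?sqr_ge0 ?addr_ge0 ?ltW.
- by move=> k _ _; rewrite -EFinM lee_fin mulr_ge0 ?sqr_ge0 ?addr_ge0 ?ltW.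
apply: lee_nneseries => [k _ _|k _]; first exact: sq0.
rewrite -!EFinM -EFinD lee_fin.
set a := rnorm (x k); set b := rnorm (y k).
apply: (@le_trans _ _ ((a + b) ^+ 2)).
  by rewrite ler_pXn2r ?nnegrE ?addr_ge0 ?rnorm_ge0// rnormD.
rewrite -subr_ge0.
have -> : (1 + t) * a ^+ 2 + (1 + t^-1) * b ^+ 2 - (a + b) ^+ 2 =
          t * (a - t^-1 * b) ^+ 2.
  rewrite !sqrrB !sqrrD; field; exact: lt0r_neq0.
by rewrite mulr_ge0 ?sqr_ge0// ltW.
Qed.

Lemma ell2_submod_closed : submod_closed ell2_pred.
Proof.
have fin_mul (r : R) (s : \bar R) : 0 <= r -> (0 <= s)%E -> (s < +oo)%E ->
    (r%:E * s < +oo)%E.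
  by move=> r0; case: s => // s _ _; rewrite -EFinM ltry.
split=> [|a x y].
  apply/asboolP; rewrite /sqnorm2 eseries0 ?ltry// => k _ _.
  by rewrite rnorm0 expr0n.
move=> /asboolP xoo /asboolP yoo; apply/asboolP.
apply: le_lt_trans (sqnorm2D _ _ ltr01) _.
rewrite sqnorm2Z invr1; apply: lte_add_pinfty.
  apply: (fin_mul); rewrite ?addr_ge0 ?ler01 ?mule_ge0 ?lee_fin ?sqnorm2_ge0
    ?sqr_ge0//.
  by apply: fin_mul => //; rewrite ?sqr_ge0 ?sqnorm2_ge0.
by apply: fin_mul => //; rewrite ?addr_ge0 ?ler01 ?sqnorm2_ge0.
Qed.

HB.instance Definition _ := GRing.isSubmodClosed.Build _ _ ell2_pred
  ell2_submod_closed.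
HB.instance Definition _ := [SubChoice_isSubLmodule of ell2 by <:].

Definition ell2_norm (x : ell2) : R := Num.sqrt (fine (sqnorm2 x)).

Lemma ell2_normK (x : ell2) : ((ell2_norm x) ^+ 2)%:E = sqnorm2 x.
Proof.
have /asboolP xoo := ell2P x.
by rewrite sqr_sqrtr ?fine_ge0 ?sqnorm2_ge0// fineK// ge0_fin_numE ?sqnorm2_ge0.
Qed.

Lemma ell2_norm_ge0 x : 0 <= ell2_norm x.
Proof. exact: sqrtr_ge0. Qed.

Lemma ell2_norm_eq0 x : ell2_norm x = 0 -> x = 0.
Proof.
move=> x0; have := ell2_normK x; rewrite x0 expr0n/= => /esym sx0.
apply/val_inj/funext => k /=; apply: rnorm_eq0; apply/eqP.
rewrite -sqrf_eq0 eq_le sqr_ge0 andbT -lee_fin -sx0.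
rewrite /sqnorm2 (@nneseriesD1 _ _ k)//; last first.
  by move=> n _; rewrite lee_fin sqr_ge0.
by rewrite leeDl// nneseries_ge0// => n _ _; rewrite lee_fin sqr_ge0.
Qed.

Lemma ell2_normZ (a : R[i]) x : ell2_norm (a *: x) = rnorm a * ell2_norm x.
Proof.
apply/eqP; rewrite -(@eqrXn2 _ 2)// ?mulr_ge0 ?ell2_norm_ge0 ?rnorm_ge0//.
by rewrite -eqe exprMn (EFinM (rnorm a ^+ 2)) !ell2_normK sqnorm2Z.
Qed.

Lemma ell2_normD x y : ell2_norm (x + y) <= ell2_norm x + ell2_norm y.
Proof.
have [/eqP/ell2_norm_eq0->|x0] := boolP (ell2_norm x == 0).
  by rewrite add0r lerDr ell2_norm_ge0.
have [/eqP/ell2_norm_eq0->|y0] := boolP (ell2_norm y == 0).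
  by rewrite addr0 lerDl ell2_norm_ge0.
have px : 0 < ell2_norm x by rewrite lt_def x0 ell2_norm_ge0.
have py : 0 < ell2_norm y by rewrite lt_def y0 ell2_norm_ge0.
rewrite -(@ler_pXn2r _ 2) ?nnegrE ?addr_ge0 ?ell2_norm_ge0// -lee_fin.
rewrite ell2_normK; apply: le_trans (sqnorm2D _ _ (divr_gt0 py px)) _.
rewrite -!ell2_normK -!EFinM -EFinD lee_fin le_eqVlt; apply/orP; left.
by apply/eqP; field; rewrite x0 y0.
Qed.

End Ell2.

Section Ell2NormedModule.
Context (R : realType).

Let norm (x : ell2 R) : R[i] := ((ell2_norm x)%:C)%C.

Let normD (x y : ell2 R) : norm (x + y) <= norm x + norm y.
Proof. by rewrite /norm -rmorphD lecR ell2_normD. Qed.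

Let normZ (a : R[i]) (x : ell2 R) : norm (a *: x) = `|a| * norm x.
Proof. by rewrite /norm ell2_normZ rmorphM/= -rnormE. Qed.

Let norm0_eq0 (x : ell2 R) : norm x = 0 -> x = 0.
Proof. by move=> /complexI/ell2_norm_eq0. Qed.

HB.instance Definition _ :=
  Lmodule_isNormed.Build R[i] (ell2 R) normD normZ norm0_eq0.

End Ell2NormedModule.

Section Ell2Basis.
Context (R : realType).

Let basis_seq (j k : nat) : R[i] := (k == j)%:R.

Let basis_seqP j : basis_seq j \in @ell2_pred R.
Proof.
apply/asboolP; rewrite /sqnorm2 (@nneseries_split _ _ 0 j.+1)/=; last first.
  by move=> k _; rewrite lee_fin sqr_ge0.
rewrite eseries0 ?adde0; last first.
  move=> k jk _; rewrite /basis_seq gtn_eqF ?rnorm0 ?expr0n//.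
by rewrite sumEFin ltry.
Qed.

Definition ell2_basis (j : nat) : ell2 R := Ell2 (basis_seqP j).

End Ell2Basis.

Section Operators.
Context (R : realType).

Record bounded_operator (V : normedModType R[i]) : Type := BoundedOperator {
  operator_fun :> {linear V -> V} ;
  operator_continuous : continuous operator_fun }.

Definition opnorm (V : normedModType R[i]) (T : V -> V) : \bar R :=
  ereal_sup [set (rnorm (T x))%:E | x in [set x : V | rnorm x <= 1]].

Definition power_bounded (V : normedModType R[i]) (T : bounded_operator V) :=
  (ereal_sup [set opnorm (iter n T) | n in [set n : nat | (1 <= n)%N]] < +oo)%E.

(* (i, j) entry: the i-th coordinate of T e_j, that is <T e_j, e_i>. *)
Definition operator_matrix (T : bounded_operator (ell2 R)) (i j : nat) : R[i] :=
  T (ell2_basis R j) i.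

(* Phi T is the operator with matrix (a_ij T_ij). A bounded operator is
   determined by its matrix, so Phi is unique, hence linear. *)
Definition bounded_schur_multiplier (a : nat -> nat -> R[i]) : Prop :=
  exists Phi : bounded_operator (ell2 R) -> bounded_operator (ell2 R),
    (forall T i j,
       operator_matrix (Phi T) i j = a i j * operator_matrix T i j) /\
    (exists M : R, forall T, (opnorm (Phi T) <= M%:E * opnorm T)%E).

(* A Hilbert space is a complete normed space over R[i] whose norm is given by
   an inner product, linear in its first argument. *)
Definition is_inner_product (H : completeNormedModType R[i])
    (dot : {dot H for Num.conj}) : Prop :=
  forall x : H, `|x| = sqrtC (dot x x).

End Operators.

(* Main.v *)
Require Import Defs.
From mathcomp Require Import all_boot all_order all_algebra.
From mathcomp Require Import complex.
From mathcomp Require Import all_classical all_reals all_analysis.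
From HB Require Import structures.
From mathcomp Require Import ring lra zify.
Import Order.TTheory GRing.Theory Num.Theory.
Import numFieldNormedType.Exports.
Local Open Scope ring_scope.
Set Implicit Arguments.
Unset Strict Implicit.
Unset Printing Implicit Defensive.

(** The symbol [phi] is a sum of bumps with disjoint supports: around
    M_j = 8 * 16 ^ j it is s |-> a_j w_j ^ s tent_j(s), with a_j > 0, w_j a
    root of unity, and tent_j a tent function of height 1 at M_j.

    Bounded Schur multiplier. If p + q lies in the support of the j-th bump,
    then the larger of p and q lies in the j-th block, which is the set of all
    s with 16 ^ j <= s < 16 ^ (j + 1). So ([phi_split]) the Hankel matrix is
    the sum of the matrix whose (q, p) entry is the value at p + q of the bump
    indexed by the block of q, and of its transpose, minus the part where p and
    q share a block. In the first matrix the bump is a function of q alone.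
    Since a tent is a correlation of two indicators of intervals, this matrix
    is a Gram matrix with entries sum_t y_q(t) x_p(t), where t runs over pairs
    (bump, position), y_q lives on the bump of its block, |y_q| <= 1 and
    |x_p|^2 <= sum_j a_j^2 ([bump_gram]). Gram matrices of bounded families are
    bounded Schur multipliers ([gram_bounded_schur_multiplier]); hence it is
    enough that sum_j a_j^2 be finite, with no constraint on the w_j.

    Not a coefficient.  For 2 ^ k <= j < 2 ^ (k + 1) let a_j = (2 / 3) ^ k
    and w_j = w ^ j with w a primitive root of unity of order n = 2 ^ k; the
    squares a_j^2 are summable.  Suppose phi(s) = <T^s xi, eta>, and consider
      S = sum_(r, m, p < n) conj (w ^ (m (r + p))) phi(r + M_(n + m) + p).
    All terms are real and at least a_n / 2, so S is at least of order
    n^3 a_n.  On the other hand S = sum_r <T^r V_r, eta>, where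
    V_r = sum_m conj (w ^ (r m)) T^(M_(n + m)) X_m and
    X_m = sum_p conj (w ^ (m p)) T^p xi.  Parseval's identity for the discrete
    Fourier transform in a Hilbert space ([dft_parseval]), used once over m
    and once over p, and power boundedness, used for the three factors of
    T^(r + M_(n + m) + p), show that S is at most of order n^2.  Hence
    n a_n = (4 / 3) ^ k is bounded in k ([coefficient_growth]), which is
    absurd. *)

(** * The real-valued norm and operator bounds *)

Section Modulus.
Context (R : realType).

Lemma rnormZ (V : normedModType R[i]) (a : R[i]) (x : V) :
  rnorm (a *: x) = rnorm a * rnorm x.
Proof. by apply: complexI; rewrite rmorphM/= -!rnormE normrZ. Qed.

Lemma rnormN (V : normedZmodType R[i]) (x : V) : rnorm (- x) = rnorm x.
Proof. by rewrite /rnorm normrN. Qed.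

Lemma rnorm_sum (V : normedZmodType R[i]) (I : Type) (r : seq I) (F : I -> V) :
  rnorm (\sum_(i <- r) F i) <= \sum_(i <- r) rnorm (F i).
Proof.
elim/big_ind2 : _ => [|x a y b xa yb|//]; first by rewrite rnorm0.
by apply: le_trans (rnormD _ _) _; exact: lerD.
Qed.

Lemma rnormR (a : R) : rnorm (a%:C)%C = `|a|.
Proof.
apply: complexI; rewrite -rnormE.
have [a0|/ltW a0] := leP 0 a; first by rewrite !ger0_norm ?lecR.
by rewrite !ler0_norm ?lecR// rmorphN.
Qed.

Lemma rnorm1 : rnorm (1 : R[i]) = 1.
Proof. by rewrite -[1](rmorph1 (real_complex R)) rnormR normr1. Qed.

Lemma rnormX (z : R[i]) n : rnorm (z ^+ n) = rnorm z ^+ n.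
Proof. by elim: n => [|n ih]; rewrite ?expr0 ?rnorm1// !exprS rnormM ih. Qed.

Lemma CauchySchwarz_sum (I : finType) (a b : I -> R) :
  (\sum_i a i * b i) ^+ 2 <= (\sum_i a i ^+ 2) * (\sum_i b i ^+ 2).
Proof.
set A := \sum_i a i ^+ 2; set B := \sum_i b i ^+ 2; set S := \sum_i a i * b i.
have B0 : 0 <= B by apply: sumr_ge0 => i _; exact: sqr_ge0.
have quad t : 0 <= A - 2 * t * S + t ^+ 2 * B.
  have -> : A - 2 * t * S + t ^+ 2 * B = \sum_i (a i - t * b i) ^+ 2.
    rewrite !mulr_sumr -sumrB -big_split/=; apply: eq_bigr => i _; ring.
  by apply: sumr_ge0 => i _; exact: sqr_ge0.
have [B_eq0|BN0] := eqVneq B 0.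
  have b0 i : b i = 0.
    have /psumr_eq0P := B_eq0.
    move=> /(_ (fun j _ => sqr_ge0 (b j)))/(_ i isT)/eqP.
    by rewrite sqrf_eq0 => /eqP.
  by rewrite B_eq0 mulr0 /S big1 ?expr0n// => i _; rewrite b0 mulr0.
have Bgt0 : 0 < B by rewrite lt_def BN0.
(* S / B minimizes the quadratic polynomial. *)
have := quad (S / B).
have -> : A - 2 * (S / B) * S + (S / B) ^+ 2 * B = (A * B - S ^+ 2) / B by
  field.
by rewrite pmulr_lge0 ?invr_gt0// subr_ge0.
Qed.

Lemma sq_rnorm_sum_le (I : finType) (a b : I -> R[i]) :
  rnorm (\sum_i a i * b i) ^+ 2 <=
  (\sum_i rnorm (a i) ^+ 2) * (\sum_i rnorm (b i) ^+ 2).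
Proof.
apply: le_trans (CauchySchwarz_sum _ _).
rewrite ler_pXn2r ?nnegrE ?rnorm_ge0//.
  by apply: le_trans (rnorm_sum _ _) _; under eq_bigr do rewrite rnormM.
by apply: sumr_ge0 => i _; rewrite mulr_ge0 ?rnorm_ge0.
Qed.

End Modulus.

Section OperatorNorm.
Context (R : realType) (V : normedModType R[i]).

Lemma opnorm_leP (F : {linear V -> V}) (C : R) :
  (opnorm F <= C%:E)%E -> forall x, rnorm (F x) <= C * rnorm x.
Proof.
move=> FC x; have [/rnorm_eq0 ->|x0] := eqVneq (rnorm x) 0.
  by rewrite linear0 !rnorm0 mulr0.
have xgt0 : 0 < rnorm x by rewrite lt_def x0 rnorm_ge0.
have : ((rnorm (F (((rnorm x)^-1)%:C%C *: x)))%:E <= C%:E)%E.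
  apply: le_trans FC; apply: ereal_sup_ubound.
  exists (((rnorm x)^-1)%:C%C *: x) => //=.
  by rewrite rnormZ rnormR ger0_norm ?invr_ge0 ?rnorm_ge0// mulVf.
rewrite linearZ rnormZ rnormR lee_fin ger0_norm ?invr_ge0 ?rnorm_ge0//.
by rewrite mulrC ler_pdivrMr.
Qed.

Lemma opnorm_le (F : V -> V) (C : R) : 0 <= C ->
  (forall x, rnorm (F x) <= C * rnorm x) -> (opnorm F <= C%:E)%E.
Proof.
move=> C0 FC; apply: ge_ereal_sup => _ [x /= x1 <-].
by rewrite lee_fin (le_trans (FC x))// ler_piMr.
Qed.

Lemma opnorm_ge0 (F : {linear V -> V}) : (0 <= opnorm F)%E.
Proof.
apply: ereal_sup_ubound; exists 0 => /=; first by rewrite rnorm0 ler01.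
by rewrite linear0 rnorm0.
Qed.

Lemma bounded_operator_bound (T : bounded_operator V) :
  exists2 C : R, 0 <= C & forall x, rnorm (T x) <= C * rnorm x.
Proof.
have /linear_boundedP[M [Mr TM]] :=
  (@linear_bounded_continuous _ _ _ T).2 (@operator_continuous _ _ T).
pose C : R := `|complex.Re M| + 1.
have CM : (M < C%:C%C).
  rewrite -(RRe_real Mr) ltcR; rewrite (le_lt_trans (ler_norm _))//.
  by rewrite /C/= ltrDl.
exists C; first by rewrite /C addr_ge0.
by move=> x; rewrite -lecR rmorphM/= -!rnormE; exact: TM CM x.
Qed.

Lemma opnorm_fin (T : bounded_operator V) :
  exists2 C : R, 0 <= C & opnorm T = C%:E.
Proof.
have [C C0 TC] := bounded_operator_bound T.
have := opnorm_le C0 TC; have := opnorm_ge0 T.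
by case: (opnorm T) => // r; rewrite lee_fin => r0 _; exists r.
Qed.

Lemma bound_continuous (F : {linear V -> V}) (C : R) :
  (forall x, rnorm (F x) <= C * rnorm x) -> continuous F.
Proof.
move=> FC; apply: bounded_linear_continuous; apply/linear_boundedP.
exists (C%:C)%C; split; first by rewrite /= complex_real.
move=> r Cr x; rewrite rnormE (le_trans (y := ((C * rnorm x)%:C)%C)) ?lecR//.
by rewrite rmorphM/= -rnormE ler_wpM2r// ltW.
Qed.

Lemma iter_linear (F : {linear V -> V}) n : linear (iter n F).
Proof. by move=> a x y; elim: n => //= n ->; rewrite linearP. Qed.

Lemma power_bounded_bound (T : bounded_operator V) : power_bounded T ->
  exists2 C : R, 0 <= C & forall n x, rnorm (iter n T x) <= C * rnorm x.
Proof.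
rewrite /power_bounded; set s := ereal_sup _ => soo.
have sge n : (1 <= n)%N -> (opnorm (iter n T) <= s)%E.
  by move=> n1; apply: ereal_sup_ubound; exists n.
have [C sC] : exists C : R, (s <= C%:E)%E.
  by case: s soo {sge} => [r|//|] _; [exists r|exists 0; rewrite leNye].
exists (Num.max 1 C); first by rewrite le_max ler01.
move=> [|n] x; first by rewrite /= ler_peMl ?rnorm_ge0// le_max lexx.
pose L : {linear V -> V} := HB.pack (iter n.+1 T)
  (GRing.isLinear.Build _ _ _ _ _ (iter_linear T n.+1)).
have LC : (opnorm L <= C%:E)%E by apply: le_trans sC; exact: sge.
apply: le_trans (opnorm_leP LC x) _.
by rewrite ler_wpM2r ?rnorm_ge0// le_max lexx orbT.
Qed.

End OperatorNorm.

(** * The space ell2 *)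

Section Ell2Facts.
Context (R : realType).
Implicit Types (v w : ell2 R) (a : nat -> R[i]).

Lemma ell2D v w k : (v + w) k = v k + w k.
Proof. by []. Qed.

Lemma ell2Z (c : R[i]) v k : (c *: v) k = c * v k.
Proof. by []. Qed.

Lemma ell2N v k : (- v) k = - v k.
Proof. by []. Qed.

Lemma ell2_sumE (I : Type) (r : seq I) (F : I -> ell2 R) k :
  (\sum_(i <- r) F i) k = \sum_(i <- r) F i k.
Proof. by elim/big_rec2 : _ => [//|i x y _ <-]; rewrite ell2D. Qed.

Lemma ell2_ext v w : (forall k, v k = w k) -> v = w.
Proof. by move=> vw; apply/val_inj/funext. Qed.

Lemma sq0E (z : R[i]) : (0 <= (rnorm z ^+ 2)%:E)%E.
Proof. by rewrite lee_fin sqr_ge0. Qed.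

Lemma ell2_norm_psum v n : \sum_(k < n) rnorm (v k) ^+ 2 <= ell2_norm v ^+ 2.
Proof.
rewrite -lee_fin ell2_normK -sumEFin.
rewrite -(big_mkord xpredT (fun k => (rnorm (v k) ^+ 2)%:E)).
by apply: nneseries_lim_ge => k _ _; exact: sq0E.
Qed.

Lemma sqnorm2_le (x : nat -> R[i]) (C : R) :
  (forall n, \sum_(k < n) rnorm (x k) ^+ 2 <= C) -> (sqnorm2 x <= C%:E)%E.
Proof.
move=> xC; apply: lime_le; first by apply: is_cvg_nneseries => k _ _;
  exact: sq0E.
by apply: nearW => n; rewrite big_mkord sumEFin lee_fin.
Qed.

Lemma ell2_normsq_le v (C : R) :
  (forall n, \sum_(k < n) rnorm (v k) ^+ 2 <= C) -> ell2_norm v ^+ 2 <= C.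
Proof. by move=> /sqnorm2_le; rewrite -ell2_normK lee_fin. Qed.

Lemma ell2_norm_le v (C : R) : 0 <= C ->
  (forall n, \sum_(k < n) rnorm (v k) ^+ 2 <= C ^+ 2) -> ell2_norm v <= C.
Proof.
by move=> C0 /ell2_normsq_le; rewrite ler_pXn2r ?nnegrE ?ell2_norm_ge0.
Qed.

Lemma ell2_coord_le v k : rnorm (v k) <= ell2_norm v.
Proof.
rewrite -(@ler_pXn2r _ 2) ?nnegrE ?ell2_norm_ge0 ?rnorm_ge0//.
apply: le_trans (ell2_norm_psum v k.+1).
by rewrite big_ord_recr/= lerDr sumr_ge0// => i _; exact: sqr_ge0.
Qed.

Lemma ell2_predP (x : nat -> R[i]) (C : R) :
  (forall n, \sum_(k < n) rnorm (x k) ^+ 2 <= C) -> x \in @ell2_pred R.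
Proof.
by move=> /sqnorm2_le xC; apply/asboolP; exact: le_lt_trans xC (ltry _).
Qed.

Lemma diag_psum a (A : R) v : (forall k, rnorm (a k) <= A) ->
  forall n, \sum_(k < n) rnorm (a k * v k) ^+ 2 <= (A * ell2_norm v) ^+ 2.
Proof.
move=> aA n; rewrite exprMn.
apply: le_trans (ler_wpM2l (sqr_ge0 _) (ell2_norm_psum v n)).
rewrite mulr_sumr; apply: ler_sum => k _;
  rewrite rnormM exprMn ler_wpM2r ?sqr_ge0//.
by rewrite ler_pXn2r ?nnegrE ?rnorm_ge0// (le_trans (rnorm_ge0 _) (aA k)).
Qed.

(** Multiplication by the sequence [a], bounded by [A]; a row of a Schur
    multiplier acts in this way on ell2. *)
Definition diag_mul a (A : R) (aA : forall k, rnorm (a k) <= A) v : ell2 R :=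
  Ell2 (ell2_predP (x := fun k => a k * v k) (diag_psum v aA)).

Lemma diag_mulE a A (aA : forall k, rnorm (a k) <= A) v k :
  diag_mul aA v k = a k * v k.
Proof. by []. Qed.

Lemma diag_mul_linear a A (aA : forall k, rnorm (a k) <= A) :
  linear (diag_mul aA).
Proof.
by move=> c v w; apply: ell2_ext => k; rewrite !(ell2D, ell2Z, diag_mulE); ring.
Qed.

Lemma diag_mul_le a A (aA : forall k, rnorm (a k) <= A) v : 0 <= A ->
  ell2_norm (diag_mul aA v) <= A * ell2_norm v.
Proof.
move=> A0; apply: ell2_norm_le; first by rewrite mulr_ge0 ?ell2_norm_ge0.
exact: diag_psum.
Qed.

Lemma ell2_basisE j k : ell2_basis R j k = (k == j)%:R.
Proof. by []. Qed.

(** The finitely supported sequence with the first [m] terms of [a], for an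
    arbitrary sequence [a]. *)
Definition ell2_trunc m a : ell2 R := \sum_(j < m) a j *: ell2_basis R j.

Lemma ell2_truncE m a k : ell2_trunc m a k = if (k < m)%N then a k else 0.
Proof.
rewrite ell2_sumE; under eq_bigr do rewrite ell2Z ell2_basisE.
case: ltnP => km.
  rewrite (bigD1 (Ordinal km))//= eqxx mulr1 big1 ?addr0// => j.
  by rewrite -val_eqE/= eq_sym => /negPf ->; rewrite mulr0.
by rewrite big1// => j _; rewrite gtn_eqF ?mulr0// (leq_trans _ km).
Qed.

Lemma ell2_trunc_norm m a :
  ell2_norm (ell2_trunc m a) ^+ 2 <= \sum_(j < m) rnorm (a j) ^+ 2.
Proof.
apply: ell2_normsq_le => n; set F := fun k => rnorm (ell2_trunc m a k) ^+ 2.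
apply: (@le_trans _ _ (\sum_(k < m + n) F k)).
  by rewrite addnC big_split_ord/= lerDl sumr_ge0// => k _; exact: sqr_ge0.
rewrite big_split_ord/= [X in _ + X]big1 ?addr0 => [|k _].
  by apply: ler_sum => k _; rewrite /F ell2_truncE ltn_ord.
by rewrite /F ell2_truncE ltnNge leq_addr rnorm0 expr0n.
Qed.

Lemma ell2_trunc_cvg v :
  (ell2_norm (v - ell2_trunc m v) @[m --> \oo] --> (0 : R))%classic.
Proof.
have /asboolP voo := ell2P v.
have := nneseries_tail_cvg voo (fun k _ => sq0E (v k)).
move/fine_cvg => /= tail0.
have : (Num.sqrt (fine (\sum_(m <= k <oo) (rnorm (v k) ^+ 2)%:E)) @[m --> \oo]
   --> Num.sqrt (0 : R))%classic.
  by apply: (continuous_cvg _ _ tail0); exact: sqrt_continuous.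
rewrite sqrtr0; apply: cvg_trans; apply: near_eq_cvg; apply: nearW => m.
rewrite /ell2_norm; congr (Num.sqrt (fine _)).
rewrite /sqnorm2 (nneseries_split 0 m) ?add0n; last by move=> k _; exact: sq0E.
rewrite big_mkord big1 ?add0e; last first.
  by move=> k _; rewrite ell2D ell2N ell2_truncE ltn_ord subrr rnorm0 expr0n.
rewrite eseries_cond [RHS]eseries_cond; apply: eq_eseriesr => k mk.
by rewrite ell2D ell2N ell2_truncE ltnNge (andP mk).2 subr0.
Qed.

End Ell2Facts.

(** * Gram matrices are bounded Schur multipliers *)

Section GramFactorization.
Context (R : realType).

(** [a i j] is the pairing of a vector [y i] and a vector [x j], with squared
    norms at most [Y] and [X].  The finite index set is allowed to depend on
    the size [n] of the corner of [a] that is factorized, which avoids infinite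
    sums and makes the notion symmetric in rows and columns. *)
Definition gram_factorizable (a : nat -> nat -> R[i]) (X Y : R) : Prop :=
  forall n, exists (I : finType) (x y : nat -> I -> R[i]),
    [/\ forall j, \sum_t rnorm (x j t) ^+ 2 <= X,
        forall i, \sum_t rnorm (y i t) ^+ 2 <= Y &
        forall i j, (i < n)%N -> (j < n)%N -> a i j = \sum_t y i t * x j t].

Variables (a : nat -> nat -> R[i]) (X Y : R).
Hypothesis aXY : gram_factorizable a X Y.

Lemma gram_ge0 : 0 <= X /\ 0 <= Y.
Proof.
have [I [x [y [xX yY _]]]] := aXY 0.
split; [apply: le_trans (xX 0%N)|apply: le_trans (yY 0%N)];
  by apply: sumr_ge0 => t _; exact: sqr_ge0.
Qed.

Let A := Num.sqrt (X * Y).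
Let A0 : 0 <= A. Proof. exact: sqrtr_ge0. Qed.
Let AE : A ^+ 2 = X * Y.
Proof. by have [X0 Y0] := gram_ge0; rewrite sqr_sqrtr// mulr_ge0. Qed.

Lemma gram_entry_le i j : rnorm (a i j) <= A.
Proof.
have [I [x [y [xX yY ->]]]] := aXY (maxn i j).+1;
  rewrite ?ltnS ?leq_maxl ?leq_maxr//.
rewrite -(@ler_pXn2r _ 2) ?nnegrE ?rnorm_ge0// AE mulrC.
apply: le_trans (sq_rnorm_sum_le _ _) _; apply: ler_pM => //;
  by apply: sumr_ge0 => t _; exact: sqr_ge0.
Qed.

(** On finite corners: with D_y the diagonal matrix of y, the Schur product of
    [a] and T is the sum over t of the D_(y(t)) T D_(x(t)), and the
    Cauchy-Schwarz inequality in t applies row by row. *)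
Lemma gram_finite_schur (T : bounded_operator (ell2 R)) (K : R) : 0 <= K ->
  (forall v, rnorm (T v) <= K * rnorm v) ->
  forall n m (c : nat -> R[i]),
  \sum_(i < n) rnorm (\sum_(j < m) a i j * operator_matrix T i j * c j) ^+ 2 <=
  (A * K) ^+ 2 * \sum_(j < m) rnorm (c j) ^+ 2.
Proof.
move=> K0 TK n m c.
have [I [x [y [xX yY axy]]]] := aXY (maxn n m).
have [X0 Y0] := gram_ge0.
pose w t := ell2_trunc m (fun j => x j t * c j).
have rowE (i : 'I_n) : \sum_(j < m) a i j * operator_matrix T i j * c j =
    \sum_t y i t * T (w t) i.
  under [RHS]eq_bigr => t _.
    rewrite /w /ell2_trunc linear_sum ell2_sumE mulr_sumr.
    under eq_bigr do rewrite linearZ ell2Z.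
    over.
  rewrite exchange_big/=; apply: eq_bigr => j _.
  rewrite axy ?(leq_trans (ltn_ord _)) ?leq_maxl ?leq_maxr// !mulr_suml.
  by apply: eq_bigr => t _; rewrite /operator_matrix; ring.
apply: (@le_trans _ _ (\sum_(i < n) Y * \sum_t rnorm (T (w t) i) ^+ 2)).
  apply: ler_sum => i _; rewrite rowE; apply: le_trans (sq_rnorm_sum_le _ _) _.
  by rewrite ler_wpM2r// sumr_ge0// => t _; exact: sqr_ge0.
rewrite -mulr_sumr exchange_big/= exprMn AE (mulrC X) -2!mulrA.
rewrite ler_wpM2l//.
apply: (@le_trans _ _ (\sum_t K ^+ 2 * \sum_(j < m) rnorm (x j t * c j) ^+ 2)).
  apply: ler_sum => t _; apply: le_trans (ell2_norm_psum _ _) _.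
  apply: (@le_trans _ _ ((K * rnorm (w t)) ^+ 2)).
    by rewrite ler_pXn2r ?nnegrE ?mulr_ge0 ?ell2_norm_ge0 ?rnorm_ge0//;
      exact: TK.
  by rewrite exprMn ler_wpM2l ?sqr_ge0//; exact: ell2_trunc_norm.
rewrite -mulr_sumr mulrCA ler_wpM2l ?sqr_ge0// exchange_big/= mulr_sumr.
apply: ler_sum => j _; under eq_bigr do rewrite rnormM exprMn.
by rewrite -mulr_suml ler_wpM2r ?sqr_ge0.
Qed.

(** The Schur product of [a] and [T] applied to [v]: its i-th entry, formally
    sum_j a_ij T_ij v_j, is the i-th entry of T applied to the pointwise product
    of the i-th row of [a] with [v], so no series has to be summed. *)
Definition schur_seq (T : bounded_operator (ell2 R)) (v : ell2 R) (i : nat) :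
  R[i] :=
  T (diag_mul (gram_entry_le i) v) i.

(** The bound passes from finitely supported [v] to all [v], since the first m
    terms [z m i] of the series of [schur_seq T v i] converge to it. *)
Lemma schur_seq_psum (T : bounded_operator (ell2 R)) (K : R) : 0 <= K ->
  (forall v, rnorm (T v) <= K * rnorm v) ->
  forall v n,
  \sum_(i < n) rnorm (schur_seq T v i) ^+ 2 <= (A * K * ell2_norm v) ^+ 2.
Proof.
move=> K0 TK v n.
pose z m (i : nat) := \sum_(j < m) a i j * operator_matrix T i j * v j.
have zE m i : schur_seq T v i - z m i =
    T (diag_mul (gram_entry_le i) (v - ell2_trunc m v)) i.
  have -> : z m i = T (diag_mul (gram_entry_le i) (ell2_trunc m v)) i.
    have -> : diag_mul (gram_entry_le i) (ell2_trunc m v) =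
        ell2_trunc m (fun j => a i j * v j).
      apply: ell2_ext => k; rewrite diag_mulE !ell2_truncE.
      by case: ifP => _; rewrite ?mulr0.
    rewrite /ell2_trunc linear_sum ell2_sumE; apply: eq_bigr => j _.
    by rewrite linearZ ell2Z /operator_matrix; ring.
  have -> : diag_mul (gram_entry_le i) (v - ell2_trunc m v) =
      diag_mul (gram_entry_le i) v - diag_mul (gram_entry_le i) (ell2_trunc m
        v).
    by apply: ell2_ext => k; rewrite !(ell2D, ell2N, diag_mulE); ring.
  by rewrite linearB ell2D ell2N.
have zcvg i : (rnorm (z m i) @[m --> \oo] --> rnorm (schur_seq T v i))%classic.
  apply/cvgrPdist_le => e e0.
  have /cvgrPdist_le/(_ (e / (K * A + 1))) := ell2_trunc_cvg v.
  have KA : 0 < K * A + 1 by rewrite ltr_wpDl ?mulr_ge0.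
  move=> /(_ (divr_gt0 e0 KA)); apply: filterS => m.
  rewrite sub0r normrN ger0_norm ?ell2_norm_ge0// ler_pdivlMr// => vm.
  have lipz : `|rnorm (schur_seq T v i) - rnorm (z m i)| <=
      rnorm (schur_seq T v i - z m i).
    rewrite ler_norml; apply/andP; split; last first.
      rewrite lerBlDr; apply: le_trans (rnormD _ _); by rewrite subrK.
    rewrite lerBrDl lerBlDr -[X in _ <= _ + X]rnormN opprB addrC.
    by apply: le_trans (rnormD _ _); rewrite subrK.
  apply: le_trans lipz _; rewrite zE; apply: le_trans (ell2_coord_le _ _) _.
  apply: le_trans (TK _) _.
  apply: le_trans (ler_wpM2l K0 (diag_mul_le (gram_entry_le i) _ A0)) _.
  apply: le_trans vm; rewrite mulrA mulrC ler_wpM2l ?ell2_norm_ge0//.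
  by rewrite lerDl.
have scvg : (\sum_(i < n) rnorm (z m i) ^+ 2 @[m --> \oo] -->
    \sum_(i < n) rnorm (schur_seq T v i) ^+ 2)%classic.
  elim: n => [|n ih].
    by under eq_fun do rewrite big_ord0; rewrite big_ord0; exact: cvg_cst.
  under eq_fun do rewrite big_ord_recr/=; rewrite big_ord_recr/=.
  by apply: cvgD => //; rewrite expr2; apply: cvgM; exact: zcvg.
apply: (ler_cvg_to scvg (cvg_cst _)); apply: nearW => m.
apply: le_trans (gram_finite_schur K0 TK n m v) _.
by rewrite [leRHS]exprMn ler_wpM2l ?sqr_ge0// ell2_norm_psum.
Qed.

Lemma schur_seqP T v : schur_seq T v \in @ell2_pred R.
Proof.
have [K K0 TK] := bounded_operator_bound T.
exact: ell2_predP (schur_seq_psum K0 TK v).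
Qed.

Lemma schur_linear T : linear (fun v => Ell2 (schur_seqP T v)).
Proof.
move=> c v w; apply: ell2_ext => i; rewrite ell2D ell2Z /= /schur_seq.
by rewrite diag_mul_linear linearP.
Qed.

Definition schur_lin T : {linear ell2 R -> ell2 R} :=
  HB.pack (fun v => Ell2 (schur_seqP T v))
    (GRing.isLinear.Build _ _ _ _ _ (schur_linear T)).

Lemma schur_lin_le (T : bounded_operator (ell2 R)) (K : R) : 0 <= K ->
  (forall v, rnorm (T v) <= K * rnorm v) ->
  forall v, rnorm (schur_lin T v) <= A * K * rnorm v.
Proof.
move=> K0 TK v; apply: ell2_norm_le; first by rewrite !mulr_ge0 ?ell2_norm_ge0.
exact: schur_seq_psum.
Qed.

Lemma schur_lin_continuous T : continuous (schur_lin T).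
Proof.
have [K K0 TK] := bounded_operator_bound T.
exact: bound_continuous (schur_lin_le K0 TK).
Qed.

Theorem gram_bounded_schur_multiplier : bounded_schur_multiplier a.
Proof.
exists (fun T => BoundedOperator (schur_lin_continuous (T := T))); split.
  move=> T i j; rewrite /operator_matrix /= /schur_seq.
  have -> : diag_mul (gram_entry_le i) (ell2_basis R j) = a i j *: ell2_basis R
    j.
    apply: ell2_ext => k; rewrite diag_mulE ell2Z ell2_basisE.
    by case: eqP => [->|_]; rewrite ?mulr0.
  by rewrite linearZ ell2Z.
exists A => T; have [K K0 TK] := opnorm_fin T.
rewrite TK -EFinM; apply: opnorm_le; first by rewrite mulr_ge0.
by apply: schur_lin_le => //; apply: opnorm_leP; rewrite TK.
Qed.

End GramFactorization.

Section GramClosure.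
Context (R : realType).
Implicit Types (a b : nat -> nat -> R[i]).

Lemma gram_ext a b X Y : (forall i j, a i j = b i j) ->
  gram_factorizable a X Y -> gram_factorizable b X Y.
Proof.
move=> ab aXY n; have [I [x [y [xX yY axy]]]] := aXY n.
by exists I, x, y; split=> // i j ni nj; rewrite -ab axy.
Qed.

Lemma gram_tr a X Y : gram_factorizable a X Y ->
  gram_factorizable (fun i j => a j i) Y X.
Proof.
move=> aXY n; have [I [x [y [xX yY axy]]]] := aXY n.
exists I, y, x; split=> // i j ni nj; rewrite axy//.
by apply: eq_bigr => t _; rewrite mulrC.
Qed.

Lemma gramN a X Y : gram_factorizable a X Y ->
  gram_factorizable (fun i j => - a i j) X Y.
Proof.
move=> aXY n; have [I [x [y [xX yY axy]]]] := aXY n.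
exists I, x, (fun i t => - y i t); split=> // i.
  by under eq_bigr do rewrite rnormN.
by move=> j ni nj; rewrite axy// -sumrN; apply: eq_bigr => t _; rewrite mulNr.
Qed.

Lemma gramD a b X Y X' Y' :
  gram_factorizable a X Y -> gram_factorizable b X' Y' ->
  gram_factorizable (fun i j => a i j + b i j) (X + X') (Y + Y').
Proof.
move=> aXY bXY n; have [I [x [y [xX yY axy]]]] := aXY n.
have [J [x' [y' [xX' yY' bxy]]]] := bXY n.
pose glue (u : nat -> I -> R[i]) (u' : nat -> J -> R[i]) i (t : I + J) :=
  match t with inl t => u i t | inr t => u' i t end.
exists (I + J)%type, (glue x x'), (glue y y'); split=> [j|i|i j ni nj];
  rewrite big_sumType/=.
- by apply: lerD.
- by apply: lerD.
- by rewrite axy ?bxy.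
Qed.

End GramClosure.

(** * Roots of unity of order a power of two *)

Section Roots.
Context (R : realType).

(** A primitive root of unity of order 2 ^ k, by iterated square roots of -1;
    the final square makes the case k = 0 uniform. *)
Definition zeta (k : nat) : R[i] := iter k sqrtC (-1) ^+ 2.

Lemma zeta_prim k : (2 ^ k).-primitive_root (zeta k).
Proof.
have h : (iter k sqrtC (-1 : R[i])) ^+ (2 ^ k) = -1.
  by elim: k => [|k ih]; rewrite ?expr1// expnS exprM iterS sqrtCK.
have z1 : zeta k ^+ (2 ^ k) = 1.
  by rewrite /zeta -exprM mulnC exprM h sqrrN expr1n.
have [m zm mk] := prim_order_exists (expn_gt0 2 k) z1.
have /(dvdn_pfactor _ _ (isT : prime 2))[e ek me] := mk.
have [ke|ek'] := leqP k e.
  by rewrite (_ : (2 ^ k)%N = m)// me; congr (2 ^ _)%N; apply/eqP;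
    rewrite eqn_leq ke.
exfalso; case: k h {z1 mk ek} zm ek' => // k h zm; rewrite ltnS => ek.
have : zeta k.+1 ^+ (2 ^ k) = 1.
  by rewrite -{2}(subnK ek) expnD mulnC exprM -me (prim_expr_order zm) expr1n.
rewrite /zeta -exprM -expnS h => /eqP; rewrite eq_sym -subr_eq0 opprK.
by rewrite -(natrD _ 1 1) pnatr_eq0.
Qed.

Lemma rnorm_prim_root n (w : R[i]) : n.-primitive_root w -> rnorm w = 1.
Proof.
move=> wn; have := prim_expr_order wn; move/(congr1 (@rnorm R _)).
rewrite rnormX rnorm1 => /eqP.
by rewrite pexpr_eq1 ?rnorm_ge0 ?(prim_order_gt0 wn)// => /eqP.
Qed.

Lemma prim_root_orth n (w : R[i]) : n.-primitive_root w ->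
  forall p q, (p < n)%N -> (q < n)%N ->
  \sum_(m < n) (w ^+ m) ^+ p * ((w ^+ m) ^+ q)^* = (n * (p == q))%:R.
Proof.
move=> wn p q pn qn.
have w1 : w * w^* = 1 by rewrite -normCK rnormE (rnorm_prim_root wn) expr1n.
pose u := w ^+ p * (w ^+ q)^*.
have uE m : (w ^+ m) ^+ p * ((w ^+ m) ^+ q)^* = u ^+ m.
  by rewrite /u exprMn -[X in _ = _ * X]rmorphXn -!exprM !(mulnC m).
under eq_bigr do rewrite uE.
have [pq|pq] := eqVneq p q.
  have u1 : u = 1 by rewrite /u pq rmorphXn -exprMn w1 expr1n.
  under eq_bigr do rewrite u1 expr1n.
  by rewrite sumr_const card_ord muln1.
have un : u ^+ n = 1.
  rewrite /u exprMn -rmorphXn -!exprM !(mulnC _ n) !exprM.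
  by rewrite (prim_expr_order wn) !expr1n rmorph1 mulr1.
have uN1 : u - 1 != 0.
  rewrite subr_eq0; apply/negP => /eqP u1; move/negP: pq; apply.
  have : w ^+ p == w ^+ q.
    apply/eqP; rewrite -[LHS]mulr1 -[X in _ * X](expr1n _ q) -w1 mulrC.
    by rewrite exprMn -mulrA -rmorphXn [X in _ * X]mulrC -/u u1 mulr1.
  by rewrite (eq_prim_root_expr wn) !modn_small.
apply: (mulfI uN1); rewrite muln0 mulr0 -subrX1 un subrr //.
Qed.

End Roots.

Section Counting.

Lemma count_window T lo W q :
  (\sum_(t < T) (lo <= q + t < lo + W) <= W)%N.
Proof.
rewrite -(big_mkord xpredT (fun t => (lo <= q + t < lo + W) : nat)).
rewrite -big_mkcond sum1_count -size_filter -{2}(size_iota lo W).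
rewrite -(size_map (addn q)); apply: uniq_leq_size.
  by rewrite map_inj_uniq ?filter_uniq ?iota_uniq//; exact: addnI.
by move=> s /mapP[t]; rewrite mem_filter => /andP[tW _] ->; rewrite mem_iota.
Qed.

Lemma sum_window (R : nmodType) (T p W : nat) (F : nat -> R) : (p + W <= T)%N ->
  \sum_(t < T | (p <= t < p + W)%N) F t = \sum_(a < W) F (p + a)%N.
Proof.
move=> pWT; rewrite big_mkcond -(subnKC pWT) !big_split_ord/=.
rewrite big1 ?add0r => [|t _]; last by rewrite leqNgt ltn_ord.
rewrite [X in _ + X]big1 ?addr0 => [|t _]; last first.
  by rewrite -[X in (_ < X)%N]addn0 ltn_add2l ltn0 andbF.
by apply: eq_bigr => a _; rewrite leq_addr ltn_add2l ltn_ord.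
Qed.

End Counting.

(** * The symbol *)

Section Construction.
Context (R : realType).

(** The bumps are grouped by [level]: level k > 0 consists of the 2 ^ k indices
    j with 2 ^ k <= j < 2 ^ (k + 1), and level 0 of j = 0 and j = 1. *)
Definition level (j : nat) : nat := trunc_log 2 j.

(** Half the length of the support of the j-th bump.  A perfect square, so that
    normalizing factors have rational square roots, and large enough for the
    tent to be at least half its height within 2 ^ (level j + 1) of its
    centre. *)
Definition width (j : nat) : nat := ((2 ^ (level j).+1) ^ 2)%N.

(** The centre of the j-th bump. *)
Definition offset (j : nat) : nat := (8 * 16 ^ j)%N.

(** The frequency of the j-th bump. *)
Definition freq (j : nat) : R[i] := zeta R (level j) ^+ j.

(** The height of the j-th bump.  The ratio lies between 1 / 2 and the inverse
    of the square root of 2: the squares are summable, but 2 ^ level j * amp j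
    is unbounded. *)
Definition amp (j : nat) : R := (2 / 3) ^+ level j.

(** The j with 16 ^ j <= s < 16 ^ (j + 1); by convention 0 for s = 0. *)
Definition block (s : nat) : nat := trunc_log 16 s.

(** The tent function of height [width j] centred at [offset j], written as a
    count of translates so that it factors as a correlation of intervals. *)
Definition tent (j s : nat) : nat :=
  \sum_(a < width j) (offset j <= s + a < offset j + width j).

(** The j-th bump. *)
Definition bump (j s : nat) : R[i] :=
  ((amp j / (width j)%:R)%:C)%C * freq j ^+ s * (tent j s)%:R.

(** The sum of all bumps; only the bump of the block of [s] can be nonzero. *)
Definition phi (s : nat) : R[i] := bump (block s) s.

Lemma expn_level_le j : (2 ^ level j <= j.+1)%N.
Proof. by case: j => // j; rewrite (leq_trans (trunc_logP _ _)). Qed.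

Lemma level_le j : (level j <= j)%N.
Proof. by rewrite -ltnS (leq_trans (ltn_expl _ (isT : (1 < 2)%N))
  (expn_level_le j)). Qed.

Lemma width_le j : (width j <= 4 * 16 ^ j)%N.
Proof.
rewrite /width -expnM mulnC expnM expnS leq_mul2l/=.
apply: (@leq_trans (4 ^ j)); first by rewrite leq_exp2l ?level_le.
by case: j => // j; rewrite leq_exp2r.
Qed.

Lemma bump_support j s : bump j s != 0 ->
  (2 * 16 ^ j <= s < 16 ^ j.+1)%N.
Proof.
rewrite /bump mulf_eq0 negb_or => /andP[_ ts].
have [a] : exists a : 'I_(width j), (offset j <= s + a < offset j + width j)%N.
  apply/existsP; apply: contraNT ts; rewrite negb_exists => /forallP h.
  by rewrite /tent big1// => a _; apply/eqP; rewrite eqb0; exact: h.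
have := ltn_ord a; have := width_le j; rewrite /offset expnS; lia.
Qed.

(** The j-th bump is supported in the j-th block, and so far from its left end
    that the larger of two summands of a point of the support is still there. *)
Lemma bump_block p q j : bump j (p + q)%N != 0 ->
  j = block (p + q)%N /\ j = maxn (block p) (block q).
Proof.
move=> /bump_support.
have blockE s : (16 ^ j <= s < 16 ^ j.+1)%N -> block s = j.
  by move=> h; apply: trunc_log_eq.
have le_block s t : (s <= t)%N -> (block s <= block t)%N.
  exact: leq_trunc_log.
move=> h; split; first by rewrite blockE//; lia.
case: (leqP p q) => pq.
  by rewrite (maxn_idPr _) ?le_block// blockE//; lia.
by rewrite (maxn_idPl _) ?le_block 1?ltnW// blockE//; lia.
Qed.

Lemma phi_split p q : phi (p + q)%N =
  bump (block q) (p + q)%N + bump (block p) (p + q)%N -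
  (block p == block q)%:R * bump (block q) (p + q)%N.
Proof.
pose z j := bump j (p + q)%N; rewrite /phi -!/(z _).
have zE j : z j != 0 -> j = block (p + q)%N /\ j = maxn (block p) (block q).
  exact: bump_block.
have z0 j : j != block (p + q)%N \/ j != maxn (block p) (block q) -> z j = 0.
  by move=> h; have [//|/zE[jE jE']] := eqVneq (z j) 0; case: h;
    rewrite -?jE -?jE' eqxx.
have -> : z (block (p + q)%N) = z (maxn (block p) (block q)).
  have [->//|ne] := eqVneq (block (p + q)%N) (maxn (block p) (block q)).
  by rewrite !z0; [|left; rewrite eq_sym|right].
case: (ltngtP (block p) (block q)) => [pq|pq|->].
- rewrite [z (block p)]z0 ?mul0r ?addr0 ?subr0//; right.
  by rewrite (maxn_idPr (ltnW pq)) ltn_eqF.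
- rewrite [z (block q)]z0 ?mul0r ?add0r ?subr0//; right.
  by rewrite (maxn_idPl (ltnW pq)) ltn_eqF.
- by rewrite mul1r addrK.
Qed.

Lemma amp_sum n : \sum_(j < n) amp j ^+ 2 <= 10.
Proof.
have dyadic K : \sum_(j < 2 ^ K) amp j ^+ 2 = 10 - 9 * (8 / 9) ^+ K.
  elim: K => [|K ih].
    (* The index 0 has amplitude 1. *)
    by rewrite big_ord_recl big_ord0 /amp /level trunc_log0 !expr0; lra.
  rewrite expnS mul2n -addnn big_split_ord/= ih.
  have -> : \sum_(i < 2 ^ K) amp (2 ^ K + i) ^+ 2 = (8 / 9) ^+ K.
    rewrite (eq_bigr (fun=> (2 / 3) ^+ K ^+ 2)) => [|i _].
      rewrite sumr_const card_ord -exprM mulnC exprM -[LHS]mulr_natl natrX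
        -exprMn.
      by congr (_ ^+ _); field.
    rewrite /amp /level (trunc_log_eq (n := K))//.
    by rewrite leq_addr expnS mul2n -addnn ltn_add2l ltn_ord.
  by rewrite exprS; field.
apply: (@le_trans _ _ (\sum_(j < 2 ^ n) amp j ^+ 2)).
  rewrite -(subnKC (ltnW (ltn_expl n (isT : (1 < 2)%N)))) big_split_ord/=.
  by rewrite lerDl sumr_ge0// => j _; exact: sqr_ge0.
by rewrite dyadic lerBlDr lerDl mulr_ge0// exprn_ge0.
Qed.

Lemma rnorm_freq j : rnorm (freq j) = 1.
Proof. by rewrite rnormX (rnorm_prim_root (zeta_prim _ _)) expr1n. Qed.

(** The first matrix of [phi_split], restricted by an arbitrary [mask] that
    depends on the column and on the block of the row.  In the index (j, t),
    [j] is a bump and [t] a position; the tent at p + q counts the positions t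
    with p <= t < p + width and offset <= q + t < offset + width. *)
Lemma bump_gram (mask : nat -> nat -> bool) :
  gram_factorizable (fun q p =>
    (mask p (block q))%:R * bump (block q) (p + q)%N) 10 1.
Proof.
move=> n.
(* For p < n and j < n, p + width j is at most T. *)
pose T := (n + width n)%N.
pose D j : R := ((2 ^ (level j).+1)%:R)^-1.
have DE j : D j ^+ 2 = (width j)%:R^-1 by rewrite exprVn -natrX.
have width0 j : (width j)%:R != 0 :> R by rewrite pnatr_eq0 -lt0n !expn_gt0.
pose x p (t : 'I_n * 'I_T) : R[i] := (mask p t.1)%:R *
  (((amp t.1 * D t.1)%:C)%C * freq t.1 ^+ p) * (p <= t.2 < p + width t.1)%N%:R.
pose y q (t : 'I_n * 'I_T) : R[i] := (t.1 == block q :> nat)%:R *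
  (((D t.1)%:C)%C * freq t.1 ^+ q) *
  (offset t.1 <= q + t.2 < offset t.1 + width t.1)%N%:R.
have rb (b : bool) : rnorm (b%:R : R[i]) ^+ 2 = b%:R.
  by case: b; rewrite ?rnorm1 ?rnorm0 ?expr1n ?expr0n.
have count_le (b : nat -> nat -> bool) j : (\sum_(t < T) b j t <= width j)%N ->
    (width j)%:R^-1 * \sum_(t < T) (b j t)%:R <= 1 :> R.
  move=> h; rewrite mulrC ler_pdivrMr ?mul1r;
    last by rewrite lt_def width0 ler0n.
  by rewrite -natr_sum ler_nat.
exists ('I_n * 'I_T)%type, x, y; split.
- move=> p; apply: le_trans (amp_sum n).
  rewrite -(pair_big xpredT xpredT (fun j t => rnorm (x p (j, t)) ^+ 2))/=.
  apply: ler_sum => j _.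
  apply: (@le_trans _ _ (\sum_(t < T) amp j ^+ 2 *
    ((width j)%:R^-1 * (p <= t < p + width j)%N%:R))).
    apply: ler_sum => t _.
    rewrite /x /= !rnormM !exprMn !rb rnormX rnorm_freq !expr1n rnormR mulr1.
    rewrite real_normK ?num_real// exprMn DE.
    rewrite -mulrA -(mulrA (amp j ^+ 2)) ler_piMl//; last by case: (mask _ _).
    by rewrite mulr_ge0 ?sqr_ge0// mulr_ge0 ?invr_ge0.
  rewrite -mulr_sumr -mulr_sumr ler_piMr ?sqr_ge0//.
  apply: (count_le (fun j t => p <= t < p + width j)%N);
    exact: (count_window T p (width j) 0).
- move=> q.
  rewrite -(pair_big xpredT xpredT (fun j t => rnorm (y q (j, t)) ^+ 2))/=.
  have yE (j : 'I_n) : \sum_(t < T) rnorm (y q (j, t)) ^+ 2 =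
      (j == block q :> nat)%:R * ((width j)%:R^-1 * \sum_(t < T)
        (offset j <= q + t < offset j + width j)%N%:R).
    rewrite !mulr_sumr; apply: eq_bigr => t _.
    rewrite /y /= !rnormM !exprMn !rb rnormX rnorm_freq !expr1n rnormR mulr1.
    by rewrite real_normK ?num_real// DE mulrA.
  under eq_bigr do rewrite yE.
  have le1 (j : nat) : (width j)%:R^-1 * \sum_(t < T)
        (offset j <= q + t < offset j + width j)%N%:R <= 1 :> R.
    apply: (count_le (fun j t => offset j <= q + t < offset j + width j)%N).
    exact: count_window.
  have [qn|qn] := ltnP (block q) n.
    rewrite (bigD1 (Ordinal qn))//= eqxx mul1r [X in _ + X]big1 ?addr0// => j.
    by rewrite -val_eqE/= => /negPf ->; rewrite mul0r.
  by rewrite big1// => j _; rewrite ltn_eqF ?mul0r// (leq_trans _ qn).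
- move=> q p qn pn.
  have bq : (block q < n)%N.
    apply: leq_ltn_trans qn; rewrite /block.
    case: q => // q; rewrite -ltnS.
    apply: leq_trans (ltn_expl _ (isT : (1 < 16)%N)) _.
    by rewrite ltnW // ltnS trunc_logP.
  rewrite -(pair_big xpredT xpredT (fun j t => y q (j, t) * x p (j, t)))/=.
  rewrite (bigD1 (Ordinal bq))//= [X in _ = _ + X]big1 ?addr0 => [|j];
    last first.
    rewrite -val_eqE/= => /negPf jq; rewrite big1// => t _.
    by rewrite /y /= jq !mul0r.
  set j := block q; rewrite /bump.
  pose ind t : R[i] := (offset j <= q + t < offset j + width j)%N%:R.
  transitivity ((mask p j)%:R *
    ((amp j / (width j)%:R)%:C%C * freq j ^+ (p + q)) *
    \sum_(t < T | (p <= t < p + width j)%N) ind t).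
    rewrite (sum_window ind) /T; last first.
      rewrite leq_add ?(ltnW pn)// /width leq_exp2r// leq_exp2l// ltnS.
      by rewrite leq_trunc_log// ltnW.
    rewrite mulrA; congr (_ * _).
    rewrite /tent natr_sum /ind; apply: eq_bigr => a _.
    by rewrite addnA (addnC q p).
  rewrite big_mkcond mulr_sumr; apply: eq_bigr => t _.
  rewrite /y /x /ind /= eqxx -DE !rmorphM/= rmorphXn/= exprD.
  case: (p <= t < p + width j)%N; rewrite /= ?mulr0 ?mulr1 ?mul1r//; ring.
Qed.

Lemma phi_schur : bounded_schur_multiplier (fun i j => phi (i + j)%N).
Proof.
apply: (@gram_bounded_schur_multiplier _ _ (10 + 1 + 10) (1 + 10 + 1)).
have all_pairs := bump_gram (fun _ _ => true).
have same_block := bump_gram (fun p j => block p == j).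
have row_and_column := gramD all_pairs (gram_tr all_pairs).
apply: gram_ext (gramD row_and_column (gramN same_block)).
by move=> i j; rewrite !mul1r (addnC i j) -phi_split.
Qed.

End Construction.

(** * Parseval identity in a Hilbert space *)

Section InnerProduct.
Context (R : realType) (H : completeNormedModType R[i]).
Variable dot : {dot H for Num.conj}.
Hypothesis dotP : is_inner_product dot.

Lemma dot_sq x : dot x x = ((rnorm x ^+ 2)%:C)%C.
Proof. by rewrite rmorphXn/= -rnormE dotP sqrtCK. Qed.

Lemma dot_suml (I : Type) (r : seq I) (F : I -> H) y :
  dot (\sum_(i <- r) F i) y = \sum_(i <- r) dot (F i) y.
Proof. exact: linear_sumlz. Qed.

Lemma dot_sumr (I : Type) (r : seq I) (F : I -> H) x :
  dot x (\sum_(i <- r) F i) = \sum_(i <- r) dot x (F i).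
Proof. exact: linear_sumr. Qed.

Lemma dotZl a x y : dot (a *: x) y = a * dot x y.
Proof. by rewrite linearZl_LR. Qed.

Lemma dotZr a x y : dot x (a *: y) = a^* * dot x y.
Proof. by rewrite linearZr_LR. Qed.

Lemma dot_sq_sum n (a : 'I_n -> R[i]) (v : 'I_n -> H) :
  dot (\sum_m a m *: v m) (\sum_m a m *: v m) =
  \sum_m \sum_m' a m * (a m')^* * dot (v m) (v m').
Proof.
rewrite dot_suml; apply: eq_bigr => m _.
rewrite dotZl dot_sumr mulr_sumr; apply: eq_bigr => m' _.
by rewrite dotZr mulrA.
Qed.

Lemma dft_parseval n (w : R[i]) (v : 'I_n -> H) : n.-primitive_root w ->
  \sum_(r < n) rnorm (\sum_(m < n) (w ^+ (r * m))^* *: v m) ^+ 2 =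
  n%:R * \sum_(m < n) rnorm (v m) ^+ 2.
Proof.
move=> wn; apply: complexI; rewrite rmorphM !rmorph_sum/= rmorph_nat mulr_sumr.
under eq_bigr do rewrite -dot_sq dot_sq_sum.
have orth (m m' : 'I_n) :
    \sum_(r < n) (w ^+ (r * m))^* * ((w ^+ (r * m'))^*)^* = (n * (m' == m))%:R.
  rewrite -(prim_root_orth wn (ltn_ord m') (ltn_ord m)).
  by apply: eq_bigr => r _; rewrite conjCK mulrC !exprM.
rewrite exchange_big/=; apply: eq_bigr => m _; rewrite exchange_big/=.
under eq_bigr do rewrite -mulr_suml orth.
rewrite (bigD1 m)//= eqxx muln1 dot_sq big1 ?addr0// => m' /negPf ->.
by rewrite muln0 mul0r.
Qed.

(** Expanding the squared norm of x - N y, a substitute for Cauchy-Schwarz. *)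
Lemma Re_dot_le (N : R) x y :
  2 * N * complex.Re (dot x y) <= rnorm x ^+ 2 + N ^+ 2 * rnorm y ^+ 2.
Proof.
have : 0 <= rnorm (x - (N%:C)%C *: y) ^+ 2 by exact: sqr_ge0.
have NJ : ((N%:C)%C : R[i])^* = (N%:C)%C by rewrite conj_Creal ?complex_real.
rewrite -lecR -dot_sq dnormB !dot_sq dotZr NJ.
have -> : (N%:C)%C * dot x y + ((N%:C)%C * dot x y)^* =
    ((2 * N * complex.Re (dot x y))%:C)%C.
  rewrite rmorphM/= NJ -mulrDr.
  rewrite -[(dot x y)^*]/((dot x y)^*%C) addcJ -(rmorph_nat (real_complex R) 2).
  by rewrite -!rmorphM mulrA (mulrC N).
rewrite rnormZ rnormR exprMn real_normK ?num_real//.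
by rewrite -rmorphD -rmorphB lecR subr_ge0.
Qed.

End InnerProduct.

(** * The symbol is not a coefficient of a power bounded operator *)

Section TestPoints.
Context (R : realType).

Lemma tent_ge j b h : (b + h <= width j)%N -> (h <= tent j (offset j + b))%N.
Proof.
move=> bh; have hW : (h <= width j)%N by exact: leq_trans (leq_addl b h) bh.
rewrite /tent.
rewrite -(big_mkord xpredT
  (fun a => (offset j <= offset j + b + a < offset j + width j) : nat)).
rewrite (big_cat_nat (leq0n h) hW)/= big_mkord; apply: leq_trans (leq_addr _ _).
rewrite -[leqLHS]card_ord -sum1_card; apply: leq_sum => a _.
rewrite lt0b -addnA leq_addr ltn_add2l.
by rewrite (leq_trans _ bh)// ltn_add2l.
Qed.

Lemma block_offset j b : (b < width j)%N -> block (offset j + b) = j.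
Proof.
by have := width_le j; rewrite /offset => *; apply: trunc_log_eq => //;
  rewrite expnS; lia.
Qed.

Lemma level_group k m : (m < 2 ^ k)%N -> level (2 ^ k + m) = k.
Proof.
move=> mk; apply: trunc_log_eq => //.
by rewrite leq_addr expnS mul2n -addnn ltn_add2l.
Qed.

Lemma freq_group k m : (m < 2 ^ k)%N -> freq R (2 ^ k + m) = zeta R k ^+ m.
Proof.
move=> mk; rewrite /freq level_group// exprD.
by rewrite (prim_expr_order (zeta_prim R k)) mul1r.
Qed.

(** The order of [freq j] divides 2 ^ level j, which divides [offset j]. *)
Lemma freq_offset j : freq R j ^+ offset j = 1.
Proof.
have -> : freq R j ^+ offset j =
    zeta R (level j) ^+ (2 ^ level j * (j * 2 ^ (3 + 4 * j - level j))).
  rewrite /freq -exprM mulnCA -expnD subnKC; last by have := level_le j; lia.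
  by rewrite /offset expnD expnM.
by rewrite exprM (prim_expr_order (zeta_prim R _)) expr1n.
Qed.

(** The phases cancel at the test points, where the tent of index
    2 ^ k + m is at least half its height. *)
Lemma phi_group k m p r : (m < 2 ^ k)%N -> (p < 2 ^ k)%N -> (r < 2 ^ k)%N ->
  exists2 c : R, (2 / 3) ^+ k / 2 <= c &
    (zeta R k ^+ (r * m))^* * ((zeta R k ^+ (m * p))^* *
      phi R (r + (offset (2 ^ k + m) + p))) = (c%:C)%C.
Proof.
move=> mk pk rk; set j := (2 ^ k + m)%N; set w := zeta R k.
have jk : level j = k by exact: level_group.
have widthE : width j = (2 * (2 * (2 ^ k * 2 ^ k)))%N.
  by rewrite /width jk (expnS 2) -mulnn; lia.
have prW : (p + r + 2 * (2 ^ k * 2 ^ k) <= width j)%N by rewrite widthE; nia.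
have W0 : 0 < (width j)%:R :> R by rewrite ltr0n expn_gt0 expn_gt0.
exists (amp R j / (width j)%:R * (tent j (offset j + (p + r)))%:R).
  rewrite /amp jk -!mulrA ler_wpM2l ?exprn_ge0//.
  rewrite ler_pdivlMl// ler_pdivrMr// -natrM ler_nat.
  rewrite {1}widthE mulnC leq_mul2r; apply/orP; right; exact: tent_ge.
have w1 n : w ^+ n * (w ^+ n)^* = 1.
  by rewrite -normCK rnormE rnormX (rnorm_prim_root (zeta_prim R k)) expr1n
    expr1n.
rewrite addnCA (addnC r p) /phi block_offset; last first.
  by rewrite -ltnS; move: prW; rewrite widthE; nia.
rewrite /bump exprD freq_offset mul1r freq_group// -exprM mulnDr exprD.
rewrite [RHS]rmorphM [X in _ = _ * X]rmorph_nat (mulnC r m).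
transitivity ((w ^+ (m * p) * (w ^+ (m * p))^*) *
  (w ^+ (m * r) * (w ^+ (m * r))^*) *
  ((amp R j / (width j)%:R)%:C%C * (tent j (offset j + (p + r)))%:R)).
  by rewrite /w; ring.
by rewrite !w1 !mul1r.
Qed.

End TestPoints.

Section NotACoefficient.
Context (R : realType) (H : completeNormedModType R[i]).
Variables (dot : {dot H for Num.conj}) (T : bounded_operator H).
Variables (xi eta : H) (C : R).
Hypothesis dotP : is_inner_product dot.
Hypothesis C0 : 0 <= C.
Hypothesis TC : forall n x, rnorm (iter n T x) <= C * rnorm x.
Hypothesis phiE : forall n, phi R n = dot (iter n T xi) eta.

Lemma power_sq_le n x : rnorm (iter n T x) ^+ 2 <= C ^+ 2 * rnorm x ^+ 2.
Proof. by rewrite -exprMn ler_pXn2r ?nnegrE ?mulr_ge0 ?rnorm_ge0. Qed.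

Lemma iter_lincomb n (I : Type) (s : seq I) (a : I -> R[i]) (v : I -> H) :
  iter n T (\sum_(i <- s) a i *: v i) = \sum_(i <- s) a i *: iter n T (v i).
Proof.
elim: n => //= n ->; rewrite linear_sum; apply: eq_bigr => i _; exact: linearZ.
Qed.

Lemma Re_sum (I : Type) (s : seq I) (F : I -> R[i]) :
  complex.Re (\sum_(i <- s) F i) = \sum_(i <- s) complex.Re (F i).
Proof.
elim: s => [|i s ih]; rewrite ?big_nil// !big_cons -ih.
by case: (F i); case: (\sum_(j <- s) F j).
Qed.

Lemma coefficient_growth k :
  (4 / 3) ^+ k <= C ^+ 6 * rnorm xi ^+ 2 + rnorm eta ^+ 2.
Proof.
pose n := (2 ^ k)%N; pose w := zeta R k.
have wn : n.-primitive_root w := zeta_prim R k.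
have n0 : 0 < n%:R :> R by rewrite ltr0n (prim_order_gt0 wn).
pose X (m : nat) := \sum_(p < n) (w ^+ (m * p))^* *: iter p T xi.
pose A (m : nat) := iter (offset (n + m)) T (X m).
pose V (r : nat) := \sum_(m < n) (w ^+ (r * m))^* *: A m.
(* Power boundedness for T^r, Parseval over m, power boundedness for A m,
   Parseval over p, power boundedness for T^p. *)
have V_le : \sum_(r < n) rnorm (iter r T (V r)) ^+ 2 <=
    C ^+ 6 * n%:R ^+ 3 * rnorm xi ^+ 2.
  apply: (@le_trans _ _ (C ^+ 2 * (n%:R * (C ^+ 2 * (n%:R *
      \sum_(p < n) C ^+ 2 * rnorm xi ^+ 2))))).
    apply: (@le_trans _ _ (\sum_(r < n) C ^+ 2 * rnorm (V r) ^+ 2)).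
      by apply: ler_sum => r _; exact: power_sq_le.
    rewrite -mulr_sumr ler_wpM2l ?sqr_ge0// (dft_parseval dotP _ wn).
    rewrite ler_wpM2l ?ler0n//.
    apply: (@le_trans _ _ (\sum_(m < n) C ^+ 2 * rnorm (X m) ^+ 2)).
      by apply: ler_sum => m _; exact: power_sq_le.
    rewrite -mulr_sumr ler_wpM2l ?sqr_ge0// (dft_parseval dotP _ wn).
    rewrite ler_wpM2l ?ler0n//; apply: ler_sum => p _; exact: power_sq_le.
  rewrite sumr_const card_ord -[_ *+ n]mulr_natl le_eqVlt; apply/orP; left.
  by apply/eqP; ring.
have V_ge : n%:R ^+ 3 * ((2 / 3) ^+ k / 2) <=
    \sum_(r < n) complex.Re (dot (iter r T (V r)) eta).
  have -> : n%:R ^+ 3 * ((2 / 3) ^+ k / 2) =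
      \sum_(r < n) \sum_(m < n) \sum_(p < n) ((2 / 3) ^+ k / 2) :> R.
    have sumc (c : R) : \sum_(i < n) c = n%:R * c.
      by rewrite sumr_const card_ord mulr_natl.
    by rewrite !sumc; ring.
  apply: ler_sum => r _; rewrite iter_lincomb dot_suml Re_sum.
  apply: ler_sum => m _; rewrite /A /X !iter_lincomb dotZl dot_suml.
  rewrite mulr_sumr Re_sum; apply: ler_sum => p _.
  rewrite dotZl -!iterD -phiE.
  have [c ck] := phi_group R (ltn_ord m) (ltn_ord p) (ltn_ord r).
  by rewrite addnA -/w -/n => ->.
(* Re_dot_le with N = n balances |T^r V_r|, of order n, and |eta|. *)
have : 2 * n%:R * \sum_(r < n) complex.Re (dot (iter r T (V r)) eta) <=
    C ^+ 6 * n%:R ^+ 3 * rnorm xi ^+ 2 + n%:R ^+ 3 * rnorm eta ^+ 2.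
  rewrite mulr_sumr; apply: (@le_trans _ _ (\sum_(r < n)
      (rnorm (iter r T (V r)) ^+ 2 + n%:R ^+ 2 * rnorm eta ^+ 2))).
    by apply: ler_sum => r _; exact: Re_dot_le.
  rewrite big_split/= lerD// sumr_const card_ord -mulr_natl le_eqVlt.
  by apply/orP; left; apply/eqP; ring.
have -> : (4 / 3) ^+ k = n%:R * (2 / 3) ^+ k :> R.
  by rewrite natrX -exprMn; congr (_ ^+ _); field.
move=> V_le'.
have n3 : 0 < n%:R ^+ 3 :> R by rewrite exprn_gt0.
rewrite -(ler_pM2l n3).
have := le_trans (ler_wpM2l (mulr_ge0 (ler0n _ 2) (ltW n0)) V_ge) V_le'.
set t := (2 / 3) ^+ k; set N := n%:R; set x := rnorm xi ^+ 2;
  set y := rnorm eta ^+ 2.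
have -> : 2 * N * (N ^+ 3 * (t / 2)) = N ^+ 3 * (N * t) by field.
by have -> : N ^+ 3 * (C ^+ 6 * x + y) = C ^+ 6 * N ^+ 3 * x + N ^+ 3 * y by
  ring.
Qed.

Lemma phi_not_coefficient : False.
Proof.
set K := C ^+ 6 * rnorm xi ^+ 2 + rnorm eta ^+ 2.
have bernoulli k : 1 + k%:R / 3 <= (4 / 3) ^+ k :> R.
  elim: k => [|k ih]; first by rewrite mul0r addr0 expr0.
  have k0 : 0 <= k%:R :> R by [].
  by rewrite exprS -[k.+1]addn1 natrD; lra.
have := archi_boundP (normr_ge0 (3 * K)); set k := Num.bound _ => Kk.
have := le_trans (bernoulli k) (coefficient_growth k); rewrite -/K => h.
have := ler_norm (3 * K); lra.
Qed.

End NotACoefficient.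

Theorem mainTheorem4 (R : realType) :
  exists phi : nat -> R[i],
    bounded_schur_multiplier (fun i j => phi (i + j)%N) /\
    ~ exists (H : completeNormedModType R[i]) (dot : {dot H for Num.conj})
        (T : bounded_operator H) (xi eta : H),
        [/\ is_inner_product dot,
            power_bounded T &
            forall n : nat, phi n = dot (iter n T xi) eta].
Proof.
exists (phi R); split; first exact: phi_schur.
move=> [H [dot [T [xi [eta [dotP /power_bounded_bound[C C0 TC] phiE]]]]]].
exact: phi_not_coefficient dotP C0 TC phiE.
Qed.
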